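(* Let $n\ge 1$ be an integer. The set of subgroups of $\mathbb{Z}^2$ of finite index $n$ is in bijection with the disjoint union of integer projective spaces $$\bigsqcup_{d\mid n,\ \frac nd=\square}\mathbb{PF}^1_d ,$$ where the union runs over the positive divisors $d$ of $n$ such that $n/d$ is a perfect square. Under this bijection (writing $M\in\mathbb{PF}^1_d$ to mean that the subgroup $M$ corresponds to an element of the component $\mathbb{PF}^1_d$) we have the following. \begin{enumerate} \item $M\in \mathbb{PF}^1_n$ if and only if there exists $(a,b)\in M$ with $\gcd(a,b)=1$, if and only if $\mathbb{Z}^2/M$ is a finite cyclic group. \item For $d\mid n$ with $n/d$ a perfect square, $M\in \mathbb{PF}^1_d$ if and only if $\mathbb{Z}^2/M\cong \mathbb{Z}/\sqrt{n/d}\,\mathbb{Z} \oplus \mathbb{Z}/\sqrt{nd}\,\mathbb{Z}$. \item The number of subgroups of $\mathbb{Z}^2$ of finite index $n$ is $\sigma(n)$, the sum of the positive divisors of $n$. \end{enumerate}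
   Context: For a positive integer $d$, $\mathbb{PF}^1_d$ is the quotient of $\{(a,b)\in\mathbb{Z}^2\mid \gcd(a,b)=1\}$ by the equivalence relation $(a,b)\sim(a',b')$ iff $d\mid ab'-ba'$. The symbol $\square$ denotes a perfect square. *)

(* Defs.v *)
From mathcomp Require Import all_boot all_algebra.
From mathcomp Require Import ring boolp classical_sets cardinality.

Set Implicit Arguments.
Unset Strict Implicit.
Unset Printing Implicit Defensive.

Import GRing.Theory.
Local Open Scope quotient_scope.
Local Open Scope classical_set_scope.
Local Open Scope card_scope.
Local Open Scope ring_scope.

Definition primitive_pair := {p : int * int | coprimez p.1 p.2}.

Definition PF1_rel (d : nat) : rel primitive_pair := fun p q =>
  (d%:Z %| (sval p).1 * (sval q).2 - (sval p).2 * (sval q).1)%Z.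

Lemma PF1_rel_refl d : reflexive (PF1_rel d).
Proof. by move=> p; rewrite /PF1_rel mulrC subrr dvdz0. Qed.

Lemma PF1_rel_sym d : symmetric (PF1_rel d).
Proof.
move=> p q; rewrite /PF1_rel -opprB rpredN.
by rewrite mulrC [X in _ - X]mulrC.
Qed.

Lemma PF1_rel_trans d : transitive (PF1_rel d).
Proof.
move=> [[a' b'] Hq] [[a b] ?] [[a'' b''] ?].
rewrite /PF1_rel /= => /dvdzP[s Hs] /dvdzP[t Ht].
have /coprimezP[[u v] /= Huv] := Hq.
apply/dvdzP; exists ((u * a + v * b) * t + (u * a'' + v * b'') * s).
rewrite mulrDl -!mulrA -Hs -Ht.
by rewrite -[LHS]mul1r -Huv; ring.
Qed.

Canonical PF1_equiv (d : nat) : equiv_rel primitive_pair :=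
  EquivRel (PF1_rel d) (@PF1_rel_refl d) (@PF1_rel_sym d) (@PF1_rel_trans d).

Definition PF1 (d : nat) := {eq_quot (PF1_equiv d)}.

Definition is_square (m : nat) : Prop := exists k : nat, m = (k ^ 2)%N.

(* The positive divisors d of n with n / d a perfect square (for n > 0, every
   d %| n is positive). *)
Definition square_codivisor (n : nat) :=
  {d : nat | (d %| n)%N /\ is_square (n %/ d)%N}.

Definition PF1_union (n : nat) := {d : square_codivisor n & PF1 (sval d)}.

(* Hence bijections with types of subgroups compare subgroups as sets. *)
Lemma zmodClosed_ext (V : zmodType) (M N : zmodClosed V) : M =i N -> M = N.
Proof.
move=> eqMN.
have {eqMN} : GRing.ZmodClosed.sort M = GRing.ZmodClosed.sort N.
  by apply/funext => x; exact: (eqMN x).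
case: M N => [M cM] [N cN] /= eqMN; case: _ / eqMN in cN *.
case: cM cN => [[o] [a]] [[o'] [a']].
by rewrite (Prop_irrelevance o o') (Prop_irrelevance a a').
Qed.

(* The index of M is the cardinality of the group Quotient.quot M of cosets. *)
Definition subgroup_of_index (n : nat) :=
  {M : zmodClosed (int * int)%type | [set: Quotient.quot M] #= `I_n}.

Definition Z2_quot (n : nat) (M : subgroup_of_index n) : zmodType :=
  Quotient.quot (sval M).

(* Z/mZ as a quotient of int by the multiples of m: unlike 'Z_m this is the
   trivial group for m = 1. *)
Definition Zmod (m : nat) : zmodType :=
  Quotient.quot (GRing.ZmodClosed.clone int (dvdz m%:Z) _).

Definition zmod_iso (A B : zmodType) : Prop :=
  exists f : {additive A -> B}, bijective f.

Definition zmod_cyclic (A : zmodType) : Prop :=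
  exists g : A, forall x : A, exists k : int, x = g *~ k.

Definition in_component (n : nat)
    (Phi : subgroup_of_index n -> PF1_union n) (M : subgroup_of_index n)
    (d : nat) : Prop :=
  sval (tag (Phi M)) = d.

Definition sigma (n : nat) : nat := (\sum_(d <- divisors n) d)%N.

(* Main.v *)
(* Both halves rest on two descriptions of a subgroup of index n.  The vectors
   congruent to a multiple of a primitive p modulo d form a subgroup with
   quotient Z/d, and scaling it by k gives index d k^2 = n and quotient
   Z/k + Z/dk, as one sees in a basis of Z^2 containing p; here k, d and the
   class of p in PF^1_d can be read off the subgroup.  On the other hand every
   subgroup of finite index has a unique Hermite basis (a, b), (0, c) with
   0 <= b < c and a c = n, which yields sigma(n) subgroups.  Dividing (a, b, c)
   by its gcd k, some b + t c becomes coprime to a, so every Hermite lattice is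
   of the first form. *)
From HB Require Import structures.
Require Import Defs.
From mathcomp Require Import all_boot all_algebra.
From mathcomp Require Import ring boolp classical_sets functions cardinality.

Set Implicit Arguments.
Unset Strict Implicit.
Unset Printing Implicit Defensive.

Import GRing.Theory Num.Theory.
Local Open Scope quotient_scope.
Local Open Scope classical_set_scope.
Local Open Scope card_scope.
Local Open Scope ring_scope.

(** * Bijections and cardinalities *)

Lemma inj_surj_bijective (T U : Type) (f : T -> U) :
  injective f -> (forall y, exists x, f x = y) -> bijective f.
Proof.
move=> f_inj f_surj; pose g y := sval (cid (f_surj y)).
have gK : cancel g f by move=> y; rewrite /g; case: cid.
by exists g => // x; apply: f_inj.
Qed.

Lemma bijective_card_eq (T U : Type) (f : T -> U) :
  bijective f -> [set: T] #= [set: U].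
Proof. by move=> /PbijTT[{}f _]; exact: (pcard_eq f). Qed.

Lemma fintype_card_eq (T : finType) : [set: T] #= `I_#|T|.
Proof.
apply/card_set_bijP; exists (fun x => val (enum_rank x)); split.
- by move=> x _ /=.
- by move=> x y _ _ /val_inj/enum_rank_inj.
- by move=> i /= lti; exists (enum_val (Ordinal lti)) => //; rewrite enum_valK.
Qed.

(** * The first isomorphism theorem *)

Section QuotientMorphism.

Variables (V A : zmodType) (M : zmodClosed V) (f : {additive V -> A}).
Hypotheses (f_surj : forall y, exists x, f x = y)
  (ker_f : forall x, (x \in M) = (f x == 0)).

Let fbar (q : Quotient.quot M) : A := f (repr q).

(** [repr (\pi x)] differs from [x] by an element of [M], which [f] kills. *)
Let fbar_pi x : fbar (\pi x) = f x.
Proof.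
apply/eqP; rewrite -subr_eq0 -raddfB -ker_f Quotient.idealrBE.
by rewrite reprK.
Qed.

Let fbar_zmod_morphism : zmod_morphism fbar.
Proof.
move=> p q; rewrite -[p]reprK -[q]reprK -[in LHS]raddfB /=.
by rewrite !fbar_pi raddfB.
Qed.

HB.instance Definition _ :=
  GRing.isZmodMorphism.Build (Quotient.quot M) A fbar fbar_zmod_morphism.

Lemma first_isomorphism : zmod_iso (Quotient.quot M) A.
Proof.
suff: bijective fbar by exists fbar.
apply: inj_surj_bijective => [p q|y].
  rewrite -[p]reprK -[q]reprK !fbar_pi => eq_f; apply/eqP.
  by rewrite -Quotient.idealrBE ker_f raddfB eq_f subrr.
by have [x <-] := f_surj y; exists (\pi x); rewrite /= fbar_pi.
Qed.

End QuotientMorphism.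

(** * The groups Z/m and their products *)

Lemma Zmod_pi_eq0 (m : nat) (x : int) :
  (\pi_(Zmod m) x == 0 :> Zmod m) = (m%:Z %| x)%Z.
Proof. by rewrite -(raddf0 \pi_(Zmod m)) -Quotient.idealrBE subr0. Qed.

Lemma Zmod_ord_bijective (m : nat) :
  (0 < m)%N -> bijective (fun i : 'I_m => \pi_(Zmod m) i%:Z).
Proof.
move=> m_gt0; apply: inj_surj_bijective => [i j|q].
  move/eqP; rewrite -subr_eq0 -raddfB Zmod_pi_eq0 -eqz_mod_dvd !modz_nat.
  by rewrite !modn_small // => /eqP[/val_inj].
have m_neq0 : m%:Z != 0 by rewrite -lt0n.
have lt_q : (`|(repr q %% m%:Z)%Z| < m)%N.
  by rewrite -ltz_nat gez0_abs ?modz_ge0 // ltz_pmod.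
exists (Ordinal lt_q); rewrite /= gez0_abs ?modz_ge0 //.
rewrite -[RHS]reprK; apply/eqP; rewrite -subr_eq0 -raddfB Zmod_pi_eq0.
by rewrite -eqz_mod_dvd modz_mod.
Qed.

Lemma Zmod_pair_card_eq (k m : nat) : (0 < k)%N -> (0 < m)%N ->
  [set: (Zmod k * Zmod m)%type] #= `I_(k * m).
Proof.
move=> /Zmod_ord_bijective[f fK Kf] /Zmod_ord_bijective[g gK Kg].
rewrite -[k in `I_(k * _)]card_ord -[m in `I_(_ * m)]card_ord -card_prod.
apply: card_eq_trans (fintype_card_eq _).
apply: (@bijective_card_eq _ _ (fun q => (f q.1, g q.2))).
exists (fun i : 'I_k * 'I_m =>
  (\pi_(Zmod k) i.1%:Z, \pi_(Zmod m) i.2%:Z)) => [[x y]|[i j]].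
  by rewrite /= Kf Kg.
by rewrite /= fK gK.
Qed.

(** * Lattices cut out by congruences *)

(** For primitive [p] this is the second coordinate of [v] in a basis of determinant 1 starting with
    [p]; it vanishes modulo [d] exactly when [v] is a multiple of [p] modulo [d]. *)
Definition det2 (p v : int * int) : int := p.1 * v.2 - p.2 * v.1.

Lemma det2_is_zmod_morphism p : zmod_morphism (det2 p).
Proof. by move=> [x y] [z t]; rewrite /det2 /=; ring. Qed.

HB.instance Definition _ p :=
  GRing.isZmodMorphism.Build (int * int)%type int (det2 p)
    (det2_is_zmod_morphism p).

(** One shape covers the Smith and the Hermite lattices, so closure is proved once. *)
Definition lattice_pred (r s t : nat) (p : int * int) : {pred int * int} :=
  fun v => [&& (r%:Z %| v.1)%Z, (s%:Z %| v.2)%Z & (t%:Z %| det2 p v)%Z].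

Lemma lattice_predE r s t p v :
  (v \in lattice_pred r s t p) =
    [&& (r%:Z %| v.1)%Z, (s%:Z %| v.2)%Z & (t%:Z %| det2 p v)%Z].
Proof. by []. Qed.

Lemma lattice_zmod_closed r s t p : zmod_closed (lattice_pred r s t p).
Proof.
split=> [|v w]; rewrite !lattice_predE.
  by rewrite (raddf0 fst) (raddf0 snd) (raddf0 (det2 p)) !dvdz0.
move=> /and3P[rv sv tv] /and3P[rw sw tw].
rewrite (raddfB fst) (raddfB snd) (raddfB (det2 p)).
by apply/and3P; split; apply: rpredB.
Qed.

HB.instance Definition _ r s t p :=
  GRing.isZmodClosed.Build (int * int)%type (lattice_pred r s t p)
    (lattice_zmod_closed r s t p).

(* [k] times the lattice of vectors congruent to a multiple of [p] modulo [d],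
   for primitive [p]. *)
Definition smith_lattice (k d : nat) (p : int * int) :
  zmodClosed (int * int)%type := lattice_pred k k (d * k) p.

(* The lattice spanned by [(a, b)] and [(0, c)]. *)
Definition hermite_lattice (a c : nat) (b : int) :
  zmodClosed (int * int)%type := lattice_pred a 1 (a * c) (a%:Z, b).

Lemma pairMz (x y k : int) : (x, y) *~ k = (x * k, y * k).
Proof.
rewrite [LHS]surjective_pairing (raddfMz fst) (raddfMz snd) /=.
by rewrite -[x *~ _]mulrzr -[y *~ _]mulrzr !intz.
Qed.

Lemma smith_latticeP k d p v : (0 < k)%N ->
  reflect (exists2 w, v = w *~ k%:Z & (d%:Z %| det2 p w)%Z)
    (v \in smith_lattice k d p).
Proof.
move=> k_gt0; have k_neq0 : k%:Z != 0 by rewrite -lt0n.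
have dvdM w : ((d * k)%N%:Z %| det2 p (w *~ k%:Z))%Z = (d%:Z %| det2 p w)%Z.
  by rewrite raddfMz /= PoszM -mulrzr intz dvdz_mul2r.
rewrite lattice_predE; apply: (iffP and3P) => [[]|[[x y] -> dw]].
  case: v => x y /= /dvdzP[x' ->] /dvdzP[y' ->].
  by rewrite -pairMz dvdM => dw; exists (x', y').
by rewrite dvdM pairMz !dvdz_mull.
Qed.

(** On [(x * a, y)] the determinant is [a * (y - b * x)], so [a] cancels from the condition modulo
    [a * c]; what remains says that [v - x (a, b)] is a multiple of [(0, c)]. *)
Lemma hermite_latticeP (a c : nat) b v : (0 < a)%N ->
  reflect (exists2 x, v.1 = x * a%:Z & (c%:Z %| v.2 - b * x)%Z)
    (v \in hermite_lattice a c b).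
Proof.
move=> a_gt0; have a_neq0 : a%:Z != 0 by rewrite -lt0n.
have detE x y : det2 (a%:Z, b) (x * a%:Z, y) = a%:Z * (y - b * x).
  by rewrite /det2 /=; ring.
rewrite lattice_predE dvd1z /=; case: v => x y /=.
apply: (iffP andP) => [[/dvdzP[z ->]]|[z ->]]; rewrite detE PoszM dvdz_mul2l //.
  by exists z.
by rewrite dvdz_mull.
Qed.

(** * Quotients of Smith lattices *)

(** A Bezout relation completes [p] by [(- w, u)] to a basis of Z^2, in which [v] has coordinates
    [u * v.1 + w * v.2] and [det2 p v]. The map reduces them modulo [k] and [d * k]. *)
Lemma smith_iso k d p : coprimez p.1 p.2 ->
  zmod_iso (Quotient.quot (smith_lattice k d p))
    (Zmod k * Zmod (d * k)%N)%type.
Proof.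
move=> /coprimezP[[u w] /= bez].
pose f (v : int * int) :=
  (\pi_(Zmod k) (u * v.1 + w * v.2), \pi_(Zmod (d * k)%N) (det2 p v)).
have f_additive : zmod_morphism f.
  move=> [x1 y1] [x2 y2]; rewrite /f raddfB /= [X in (\pi X, _)](_ : _ =
    (u * x1 + w * y1) - (u * x2 + w * y2)); last by ring.
  by rewrite raddfB (raddfB (det2 p)) [X in (_, X)]raddfB.
pose fm := GRing.isZmodMorphism.Build _ _ f f_additive.
pose F : {additive (int * int)%type -> (Zmod k * Zmod (d * k)%N)%type} :=
  HB.pack f fm.
apply: (@first_isomorphism _ _ _ F) => [[q1 q2]|v].
  exists (repr q1 * p.1 - repr q2 * w, repr q1 * p.2 + repr q2 * u).
  rewrite /= /f /det2 /=; congr pair; rewrite -[RHS]reprK; congr (\pi _).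
    by rewrite -[RHS]mulr1 -bez; ring.
  by rewrite -[RHS]mulr1 -bez; ring.
rewrite lattice_predE /= /f xpair_eqE !Zmod_pi_eq0.
(* Once [d * k] divides [det2 p v], so does [k]; as the change of basis is invertible over Z, [k]
   divides both entries of [v] iff it divides the first coordinate. *)
have [|_] := boolP (_ %| det2 p v)%Z; last by rewrite !andbF.
rewrite PoszM !andbT => dk_det.
have k_det : (k%:Z %| det2 p v)%Z by apply: dvdz_trans dk_det; apply: dvdz_mull.
apply/idP/idP => [/andP[kx ky]|kz].
  by apply: rpredD; apply: dvdz_mull.
have Dv1 : v.1 = p.1 * (u * v.1 + w * v.2) - w * det2 p v.
  by rewrite -[LHS]mul1r -bez /det2; ring.
have Dv2 : v.2 = p.2 * (u * v.1 + w * v.2) + u * det2 p v.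
  by rewrite -[LHS]mul1r -bez /det2; ring.
apply/andP; split; [rewrite Dv1; apply: rpredB|rewrite Dv2; apply: rpredD];
  exact: dvdz_mull.
Qed.

Lemma smith_card_eq k d p : (0 < k)%N -> (0 < d)%N -> coprimez p.1 p.2 ->
  [set: Quotient.quot (smith_lattice k d p)] #= `I_(d * k * k).
Proof.
move=> k_gt0 d_gt0 /(@smith_iso k d)[f /bijective_card_eq/card_eq_trans].
apply; rewrite [(d * k * k)%N]mulnC.
by apply: Zmod_pair_card_eq; rewrite ?muln_gt0 ?d_gt0.
Qed.

Lemma mem_smith_generator k d p : (0 < k)%N ->
  p *~ k%:Z \in smith_lattice k d p.
Proof.
move=> k_gt0; apply/smith_latticeP => //.
by exists p; rewrite // /det2 mulrC subrr.
Qed.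

(** The lattice lies in k Z^2, so [k] divides both entries of [q *~ m], hence [m] by Bezout. This is
    how [k] is read off the lattice. *)
Lemma smith_dvd_multiplier k d p (q : int * int) (m : int) : coprimez q.1 q.2 ->
  q *~ m \in smith_lattice k d p -> (k%:Z %| m)%Z.
Proof.
case: q => x y /coprimezP[[u w] /= bez]; rewrite lattice_predE pairMz.
move=> /and3P[/= kx ky _].
have -> : m = u * (x * m) + w * (y * m) by rewrite -[LHS]mul1r -bez; ring.
by apply: rpredD; apply: dvdz_mull.
Qed.

Lemma smith_primitive k d p : (0 < k)%N -> coprimez p.1 p.2 ->
  (exists a b : int, (a, b) \in smith_lattice k d p /\ gcdz a b = 1) <->
    k = 1%N.
Proof.
move=> k_gt0 p_prim; split=> [[a [b [abM ab1]]]|k1].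
  apply/eqP; rewrite -[k]/`|k%:Z|%N -dvdz1.
  by apply: (@smith_dvd_multiplier _ d p (a, b)); rewrite // /coprimez ab1.
exists p.1, p.2; split; last exact/eqP.
by rewrite -surjective_pairing -[p]mulr1z {}k1 mem_smith_generator.
Qed.

Lemma smith_cyclic k d p : coprimez p.1 p.2 ->
  zmod_cyclic (Quotient.quot (smith_lattice k d p)) <-> k = 1%N.
Proof.
move=> p_prim; split=> [[g g_gen]|->].
  have mem_sub v : exists i, v - repr g *~ i \in smith_lattice k d p.
    have [i Dv] := g_gen (\pi v); exists i.
    by rewrite Quotient.idealrBE raddfMz /= reprK Dv.
  have [i] := mem_sub (1, 0); have [j] := mem_sub (0, 1).
  case: (repr g) => x y; rewrite !pairMz !lattice_predE /=.
  move=> /and3P[kxj kyj _] /and3P[kxi kyi _].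
  apply/eqP; rewrite -[k]/`|k%:Z|%N -dvdz1.
  (* Modulo [k], a generator makes the identity matrix the product of the column [(i, j)] and the
     row [(x, y)], whose determinant is 0; so [k] divides 1. *)
  have -> : 1 = (1 - x * i) - (x * i) * ((0 - x * j) * 0 - (1 - y * j))
                + (0 - y * i) * (- x * j) :> int by ring.
  apply: rpredD; last exact: dvdz_mulr.
  by apply: rpredB => //; apply: dvdz_mull; rewrite mulr0 sub0r rpredN.
have /coprimezP[[u w] /= bez] := p_prim.
(* The second basis vector has determinant 1 with [p], and for [k = 1] the determinant modulo [d] is
   the only condition left. *)
pose g : int * int := (- w, u); exists (\pi g) => q; exists (det2 p (repr q)).
rewrite -[LHS]reprK -raddfMz; apply/eqP; rewrite -Quotient.idealrBE.
rewrite lattice_predE !dvd1z muln1 /= raddfB raddfMz /=.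
rewrite (_ : det2 p g = 1); last by rewrite -bez /det2 /g /=; ring.
by rewrite intz subrr dvdz0.
Qed.

(** * Dependence of a Smith lattice on its parameters *)

Lemma eq_smith_lattice k d p q : (0 < k)%N -> coprimez p.1 p.2 ->
  coprimez q.1 q.2 -> (d%:Z %| det2 p q)%Z ->
  smith_lattice k d p =i smith_lattice k d q.
Proof.
have sub_smith (r s v : int * int) : (0 < k)%N -> coprimez r.1 r.2 ->
    (d%:Z %| det2 r s)%Z -> v \in smith_lattice k d r ->
    v \in smith_lattice k d s.
  move=> k_gt0 /coprimezP[[u w] /= bez] rs /smith_latticeP[] // z -> rz.
  apply/smith_latticeP => //; exists z => //.
  (* This expands [det2 s z] in the coordinates of [s] and [z] with respect to a basis containing
     [r]. *)
  have -> : det2 s z = (u * s.1 + w * s.2) * det2 r z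
                     - (u * z.1 + w * z.2) * det2 r s.
    by rewrite -[LHS]mul1r -bez /det2; ring.
  by apply: rpredB; apply: dvdz_mull.
move=> k_gt0 p_prim q_prim pq v; apply/idP/idP; apply: sub_smith => //.
have -> : det2 q p = - det2 p q by rewrite /det2; ring.
by rewrite rpredN.
Qed.

(** Both [p *~ k] and [p' *~ k'] lie in the common lattice, so [k] and [k'] divide each other. The
    index then gives [d], and the presence of [p' *~ k] gives the congruence of [p] and [p']. *)
Lemma smith_lattice_inj k d p k' d' p' :
  (0 < k)%N -> (0 < k')%N -> (0 < d)%N ->
  coprimez p.1 p.2 -> coprimez p'.1 p'.2 ->
  (d * k * k = d' * k' * k')%N ->
  smith_lattice k d p =i smith_lattice k' d' p' ->
  [/\ k = k', d = d' & (d%:Z %| det2 p p')%Z].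
Proof.
move=> k_gt0 k'_gt0 d_gt0 p_prim p'_prim eq_index eqM.
have k'_dvd : (k' %| k)%N.
  apply: (@smith_dvd_multiplier k' d' p' p k%:Z) => //.
  by rewrite -eqM mem_smith_generator.
have k_dvd : (k %| k')%N.
  apply: (@smith_dvd_multiplier k d p p' k'%:Z) => //.
  by rewrite eqM mem_smith_generator.
have eq_k : k = k' by apply/eqP; rewrite eqn_dvd k_dvd.
move: eqM eq_index; rewrite -eq_k => eqM /eqP.
rewrite !eqn_pmul2r // => /eqP eq_d; split=> //.
have: p' *~ k%:Z \in smith_lattice k d p.
  by rewrite eqM mem_smith_generator.
move=> /smith_latticeP[] // w; case: p' w {eqM p'_prim} => x y [z t].
have k_neq0 : k%:Z != 0 by rewrite -lt0n.
by rewrite !pairMz => -[/(mulIf k_neq0)-> /(mulIf k_neq0)->].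
Qed.

(** * From Hermite bases to Smith lattices *)

(* [t] collects the primes of [a] not dividing [b]: a prime [r] of [a] divides
   exactly one of [b] and [t * c], hence not their sum. *)
Lemma coprimez_shift (a c : nat) (b : int) : (0 < a)%N ->
  coprime (gcdn a c) `|b| -> exists t : int, coprimez a%:Z (b + t * c%:Z).
Proof.
move=> a_gt0 abc1.
pose pi : nat_pred := [pred r | ~~ (r %| `|b|)%N]; pose t := (a`_pi)%N.
exists t%:Z; rewrite /coprimez; apply: contraT => g_neq1.
set s := b + t%:Z * c%:Z in g_neq1 *.
have g_gt1 : (1 < gcdn a `|s|)%N.
  have: (0 < gcdn a `|s|)%N by rewrite gcdn_gt0 a_gt0.
  by move: g_neq1; rewrite /gcdz /=; case: (gcdn _ _) => [|[|]].
have [r_pr] := (pdiv_prime g_gt1, pdiv_dvd (gcdn a `|s|)).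
set r := pdiv _ in r_pr *; rewrite dvdn_gcd => /andP[ra rs].
have [rb|rb] := boolP (r %| `|b|)%N; last first.
  have rt : (r %| t)%N.
    have: r \in primes t.
      by rewrite primes_part mem_filter inE rb mem_primes r_pr a_gt0.
    by rewrite mem_primes => /and3P[].
  case/negP: rb; rewrite -[r]/`|r%:Z|%N -dvdzE.
  have -> : b = s - t%:Z * c%:Z by rewrite /s; ring.
  by apply: rpredB => //; apply: dvdz_mulr.
have: (r %| t * c)%N.
  rewrite -[(t * c)%N]/`|(t * c)%N%:Z|%N -[r]/`|r%:Z|%N -dvdzE.
  have -> : (t * c)%N%:Z = s - b by rewrite /s PoszM; ring.
  exact: rpredB.
rewrite Euclid_dvdM // => /orP[rt|rc].
  have: r \in pi.
    by apply: (pnatP _ (part_gt0 pi a) (part_pnat pi a)).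
  by rewrite inE rb.
have: (r %| gcdn (gcdn a c) `|b|)%N by rewrite !dvdn_gcd ra rc.
by rewrite (eqP abc1) dvdn1; case: (r) r_pr => [|[|]].
Qed.

Lemma hermite_smith (a c : nat) (b : int) : (0 < a)%N -> (0 < c)%N ->
  exists k d p, [/\ (0 < k)%N, (0 < d)%N, coprimez p.1 p.2,
    (a * c = d * k * k)%N & hermite_lattice a c b =i smith_lattice k d p].
Proof.
move=> a_gt0 c_gt0; pose k := gcdn (gcdn a c) `|b|.
have k_gt0 : (0 < k)%N by rewrite !gcdn_gt0 a_gt0.
have k_neq0 : k%:Z != 0 by rewrite -lt0n.
have ka : (k %| a)%N by apply: dvdn_trans (dvdn_gcdl _ _) (dvdn_gcdl _ _).
have kc : (k %| c)%N by apply: dvdn_trans (dvdn_gcdl _ _) (dvdn_gcdr _ _).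
have kb : (k%:Z %| b)%Z by apply: dvdn_gcdr.
(* The equation defining [k] is set aside while [a], [b], [c] become multiples of an opaque [k]; it
   then says that the cofactors have gcd 1. *)
have := erefl k; rewrite {2}/k; clearbody k.
case/dvdnP: ka a_gt0 => a' ->; case/dvdnP: kc c_gt0 => c' ->.
case/dvdzP: kb => b' ->; rewrite !muln_gt0 k_gt0 !andbT => c'_gt0 a'_gt0.
rewrite abszM -!muln_gcdl => /eqP; rewrite -[X in X == _]mul1n.
rewrite eqn_pmul2r // => /eqP gcd1.
have [t p_prim] : exists t : int, coprimez a'%:Z (b' + t * c'%:Z).
  by apply: coprimez_shift; rewrite // /coprime -gcd1.
set q := b' + _ in p_prim; have a'_neq0 : a'%:Z != 0 by rewrite -lt0n.
(* Divided by [k], the lattice has index [a' * c'] and contains the primitive vector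
   [(a', b') + t (0, c')], taken as [p]. *)
exists k, (a' * c')%N, (a'%:Z, q); split; rewrite ?muln_gt0 ?a'_gt0 //.
  by rewrite mulnACA mulnA.
move=> [v1 v2]; apply/hermite_latticeP/smith_latticeP => //.
- by rewrite muln_gt0 a'_gt0.
- move=> [x /= ->] /dvdzP[z Dv2]; exists (x * a'%:Z, b' * x + z * c'%:Z).
    rewrite pairMz -mulrA -PoszM; congr (_, _).
    by rewrite -[LHS](subrK (b' * k%:Z * x)) Dv2 PoszM; ring.
  apply/dvdzP; exists (z - t * x).
  by rewrite /det2 /q /= PoszM; ring.
move=> [[w1 w2] Dv] /dvdzP[z Dz].
(* The determinant condition makes [a'] divide [q * w1], and [q] is prime to [a']. *)
have /dvdzP[x Dw1] : (a'%:Z %| w1)%Z.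
  rewrite -(Gauss_dvdzr _ p_prim).
  have -> : q * w1 = a'%:Z * (w2 - z * c'%:Z).
    by rewrite mulrBr (mulrCA _ z) -PoszM -Dz /det2 /=; ring.
  exact: dvdz_mulr.
move: Dv; rewrite pairMz => -[-> ->]; exists x.
  by rewrite /= Dw1 PoszM; ring.
apply/dvdzP; exists (z + t * x).
have /(mulfI a'_neq0) Dw2 : a'%:Z * (w2 - q * x) = a'%:Z * (z * c'%:Z).
  by rewrite (mulrCA _ z) -PoszM -Dz /det2 /= Dw1; ring.
have -> : w2 = q * x + z * c'%:Z by rewrite -Dw2; ring.
by rewrite /= /q PoszM; ring.
Qed.

Lemma hermite_card_eq (a c : nat) b : (0 < a)%N -> (0 < c)%N ->
  [set: Quotient.quot (hermite_lattice a c b)] #= `I_(a * c).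
Proof.
move=> a_gt0 c_gt0.
have [k [d [p [k_gt0 d_gt0 p_prim -> /zmodClosed_ext->]]]] :=
  hermite_smith b a_gt0 c_gt0.
exact: smith_card_eq.
Qed.

(** The vectors [(0, y)] of the lattice determine [c], the product [a * c] then gives [a], and
    membership of [(a, b)] fixes [b] modulo [c]. *)
Lemma hermite_inj (a c b a' c' b' : nat) : (0 < a)%N -> (0 < c)%N ->
  (b < c)%N -> (b' < c')%N -> (a * c = a' * c')%N ->
  hermite_lattice a c b%:Z =i hermite_lattice a' c' b'%:Z -> c = c' /\ b = b'.
Proof.
move=> a_gt0 c_gt0 lt_bc lt_b'c' eq_ac eqM.
have /andP[a'_gt0 c'_gt0] : (0 < a')%N && (0 < c')%N.
  by rewrite -muln_gt0 -eq_ac muln_gt0 a_gt0.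
have mem_vert (e f g : nat) : (0 < e)%N -> forall y,
    ((0, y) \in hermite_lattice e f g%:Z) = (f%:Z %| y)%Z.
  move=> e_gt0 y; apply/hermite_latticeP/idP => // [[x /= /esym/eqP]|fy].
    rewrite mulf_eq0 -[e%:Z == 0]/(e == 0)%N (gtn_eqF e_gt0) orbF.
    by move=> /eqP->; rewrite mulr0 subr0.
  by exists 0; rewrite ?mul0r ?mulr0 ?subr0.
have eq_c : c = c'.
  apply/eqP; rewrite eqn_dvd -[(c %| _)%N]/(c%:Z %| c'%:Z)%Z.
  rewrite -[(c' %| _)%N]/(c'%:Z %| c%:Z)%Z.
  rewrite -(mem_vert a c b) // eqM mem_vert // dvdzz /=.
  by rewrite -(mem_vert a' c' b') // -eqM mem_vert // dvdzz.
rewrite -eq_c in eq_ac lt_b'c' eqM *; split=> //.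
have eq_a : a = a' by apply/eqP; rewrite -(eqn_pmul2r c_gt0) eq_ac.
have: (a%:Z, b%:Z) \in hermite_lattice a' c b'%:Z.
  rewrite -eqM; apply/hermite_latticeP => //.
  by exists 1; rewrite ?mul1r //= mulr1 subrr.
rewrite -eq_a => /hermite_latticeP[] // x /= /eqP.
rewrite -{1}[a%:Z]mul1r (inj_eq (mulIf _)) -?lt0n // => /eqP <-.
rewrite mulr1 -eqz_mod_dvd !modz_nat !modn_small //.
by move=> /eqP[].
Qed.

(** * Hermite bases of subgroups of finite index *)

(** The generator is the least positive element, which exists thanks to [N]; a nonzero remainder
    modulo it would be smaller. *)
Lemma int_subgroup (J : zmodClosed int) N : (0 < N)%N -> N%:Z \in J ->
  exists2 c, (0 < c)%N & forall x, (x \in J) = (c%:Z %| x)%Z.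
Proof.
move=> N_gt0 NJ.
have [|c /andP[c_gt0 cJ] c_min] :=
  @ex_minnP (fun c => (0 < c)%N && (c%:Z \in J)).
  by exists N; rewrite N_gt0.
have c_neq0 : c%:Z != 0 by rewrite -lt0n.
have mulcJ q : q * c%:Z \in J by rewrite -[q]intz mulrzl; apply: rpredMz.
exists c => // x; apply/idP/dvdzP => [xJ|[q ->] //].
exists (x %/ c)%Z; rewrite [LHS](divz_eq _ c) [X in _ + X](_ : _ = 0) ?addr0 //.
have modJ : (x %% c)%Z \in J by rewrite /modz rpredB.
apply/eqP; apply: contraT => mod_neq0.
have := c_min `|(x %% c)%Z|%N.
rewrite absz_gt0 mod_neq0 gez0_abs ?modz_ge0 // modJ => /(_ isT).
by rewrite leqNgt -ltz_nat gez0_abs ?modz_ge0 // ltz_pmod.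
Qed.

(** Pigeonhole: two of the [n.+1] multiples [v *+ 0], ..., [v *+ n] share one of the [n] cosets, and
    their difference lies in [M]. *)
Lemma finite_index_multiple (V : zmodType) (M : zmodClosed V) n v :
  [set: Quotient.quot M] #= `I_n -> exists2 N, (0 < N)%N & v *+ N \in M.
Proof.
move=> /card_set_bijP[f [f_fun f_inj _]].
have f_lt q : (f q < n)%N by apply: f_fun.
pose g (i : 'I_n.+1) := Ordinal (f_lt (\pi_(Quotient.quot M) (v *+ i))).
have /injectivePn[i [j]] : ~~ injectiveb g.
  by apply/injectiveP => /leq_card; rewrite !card_ord ltnn.
wlog lt_ij : i j / (i < j)%N => [hwlog ne_ij eq_g|_ [eq_f]].
  have [lt_ij|lt_ji|/val_inj eq_ij] := ltngtP i j; first exact: (hwlog i j).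
    by apply: (hwlog j i) => //; rewrite eq_sym.
  by rewrite eq_ij eqxx in ne_ij.
exists (j - i)%N; first by rewrite subn_gt0.
rewrite mulrnBr 1?ltnW // Quotient.idealrBE; apply/eqP.
by apply: f_inj (esym eq_f); rewrite inE.
Qed.

Lemma finite_index_hermite (M : zmodClosed (int * int)%type) n :
  [set: Quotient.quot M] #= `I_n ->
  exists a c b : nat, [/\ (0 < a)%N, (b < c)%N & M =i hermite_lattice a c b%:Z].
Proof.
move=> finM.
have pairMn (x y : int) N : (x, y) *+ N = (x * N%:Z, y * N%:Z).
  by rewrite pmulrn pairMz.
have [N1 N1_gt0] := finite_index_multiple (1, 0) finM.
have [N2 N2_gt0] := finite_index_multiple (0, 1) finM.
rewrite !pairMn !mul1r !mul0r => N2M N1M.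
(* [I1] is the projection of [M] to the first axis, [I2] its intersection with the second. They
   contain [N1] and [N2], so they are generated by positive [a] and [c]. *)
pose I1 : {pred int} := fun x => `[< exists y, (x, y) \in M >].
pose I2 : {pred int} := fun y => (0, y) \in M.
have I1P x : reflect (exists y, (x, y) \in M) (x \in I1) by apply: asboolP.
have I1_closed : zmod_closed I1.
  split=> [|x1 x2 /I1P[y1 xy1] /I1P[y2 xy2]]; apply/I1P.
    by exists 0; exact: rpred0.
  by exists (y1 - y2); exact: (rpredB xy1 xy2).
have I2_closed : zmod_closed I2.
  split=> [|y1 y2 My1 My2]; first exact: rpred0.
  have := rpredB My1 My2.
  by rewrite (_ : _ - _ = (0, y1 - y2)) //; congr (_, _); exact: subrr.
pose J1 : zmodClosed int := HB.pack I1 (GRing.isZmodClosed.Build _ _ I1_closed).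
pose J2 : zmodClosed int := HB.pack I2 (GRing.isZmodClosed.Build _ _ I2_closed).
have [|a a_gt0 I1a] := @int_subgroup J1 N1 N1_gt0; first by apply/I1P; exists 0.
have [c c_gt0 I2c] := @int_subgroup J2 N2 N2_gt0 N2M.
have /I1P[b0 ab0M] : a%:Z \in J1 by rewrite I1a dvdzz.
have c_neq0 : c%:Z != 0 by rewrite -lt0n.
(* As [(0, c)] is in [M], the lift [b0] of [a] may be reduced modulo [c]. *)
exists a, c, `|(b0 %% c%:Z)%Z|%N; split=> //.
  by rewrite -ltz_nat gez0_abs ?modz_ge0 // ltz_pmod.
rewrite gez0_abs ?modz_ge0 //; set b := (b0 %% c%:Z)%Z.
have vertM y : ((0, y) \in M) = (c%:Z %| y)%Z := I2c y.
have abM : (a%:Z, b) \in M.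
  have -> : (a%:Z, b) = (a%:Z, b0) - (0, b0 - b).
    by apply/eqP; rewrite xpair_eqE /= subr0 opprB addrC subrK !eqxx.
  by apply: rpredB; rewrite // vertM -eqz_mod_dvd modz_mod.
have shift y z :
    ((z * a%:Z, y) \in M) = (c%:Z %| y - b * z)%Z.
  rewrite -vertM (_ : (0, _) = (z * a%:Z, y) - (a%:Z, b) *~ z).
    by rewrite rpredBr // rpredMz.
  by apply/eqP; rewrite pairMz xpair_eqE /= mulrC subrr !eqxx.
move=> [x y]; apply/idP/hermite_latticeP => // [xyM|[z /= ->]].
  have : x \in J1 by apply/I1P; exists y.
  by rewrite I1a => /dvdzP[z Dx]; exists z; rewrite //= -shift -Dx.
by rewrite shift.
Qed.

(** * Isomorphism classes of the quotients *)

Lemma zmod_iso_sym (A B : zmodType) : zmod_iso A B -> zmod_iso B A.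
Proof.
move=> [f [g fK gK]]; have g_additive : zmod_morphism g.
  by move=> x y; rewrite -{1}[x]gK -{1}[y]gK -raddfB fK.
pose gm := GRing.isZmodMorphism.Build _ _ g g_additive.
by exists (HB.pack g gm : {additive B -> A}); exists f.
Qed.

Lemma zmod_iso_trans (A B C : zmodType) :
  zmod_iso A B -> zmod_iso B C -> zmod_iso A C.
Proof. by move=> [f f_bij] [g g_bij]; exists (g \o f); apply: bij_comp. Qed.

(** The exponent [d * k], attained by [(0, 1)], is the isomorphism invariant that separates the
    components. *)
Lemma Zmod_pair_exponent k d N :
  (forall q : (Zmod k * Zmod (d * k)%N)%type, q *+ N = 0) <-> (d * k %| N)%N.
Proof.
have Zmod_torsion m (q : Zmod m) : (m %| N)%N -> q *+ N = 0.
  move=> mN; rewrite -[q]reprK -raddfMn; apply/eqP; rewrite Zmod_pi_eq0.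
  by rewrite -mulr_natr dvdz_mull //= natz.
split=> [killed|dkN [x y]].
  have := congr1 snd (killed (0, \pi 1)); rewrite (raddfMn snd) /= -raddfMn.
  by move/eqP; rewrite Zmod_pi_eq0 natz.
rewrite [LHS]surjective_pairing (raddfMn fst) (raddfMn snd) /=.
by rewrite !Zmod_torsion // (dvdn_trans _ dkN) ?dvdn_mull.
Qed.

Lemma Zmod_pair_iso_dvd k d k' d' :
  zmod_iso (Zmod k * Zmod (d * k)%N)%type (Zmod k' * Zmod (d' * k')%N)%type ->
  (d' * k' %| d * k)%N.
Proof.
move=> [f [g fK gK]]; apply/Zmod_pair_exponent => q.
rewrite -[q]gK -raddfMn (_ : g q *+ _ = 0) ?raddf0 //.
by move: (g q); apply/Zmod_pair_exponent.
Qed.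

(** The exponent fixes [d * k]; the common order [d * k * k] then fixes [k], and so [d]. *)
Lemma Zmod_pair_iso_inj k d k' d' : (0 < k)%N -> (0 < d)%N ->
  (d * k * k = d' * k' * k')%N ->
  zmod_iso (Zmod k * Zmod (d * k)%N)%type (Zmod k' * Zmod (d' * k')%N)%type ->
  d = d'.
Proof.
move=> k_gt0 d_gt0 eq_n iso.
have eq_dk : (d * k = d' * k')%N.
  by apply/eqP; rewrite eqn_dvd !Zmod_pair_iso_dvd //; apply: zmod_iso_sym.
move/eqP: eq_n; rewrite -eq_dk eqn_pmul2l ?muln_gt0 ?d_gt0 // => /eqP eq_k.
by apply/eqP; rewrite -(eqn_pmul2r k_gt0) eq_dk -eq_k.
Qed.

(** * Square codivisors and the divisor sum *)

Lemma square_codivisor_decomp n d : (0 < n)%N -> (d %| n)%N ->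
  is_square (n %/ d)%N ->
  let k := Nat.sqrt (n %/ d)%N in
  [/\ (0 < k)%N, (0 < d)%N, Nat.sqrt (n * d)%N = (d * k)%N & n = (d * k * k)%N].
Proof.
move=> n_gt0 dn [k Dk] /=.
have sqrtE m : Nat.sqrt (m * m)%N = m by exact: PeanoNat.Nat.sqrt_square.
have Dn : n = (d * k * k)%N.
  by rewrite -mulnA -[(k * k)%N]/(k ^ 2)%N -Dk mulnC divnK.
rewrite Dk -[(k ^ 2)%N]/(k * k)%N sqrtE {1}Dn.
have -> : (d * k * k * d = d * k * (d * k))%N.
  by rewrite -!mulnA [(k * d)%N]mulnC.
move: n_gt0; rewrite sqrtE Dn !muln_gt0 => /andP[/andP[-> ->] _].
by split.
Qed.

(** A pair [(c, b)] encodes the basis [(n / c, b)], [(0, c)]; for positive [n] the bound [n.+1]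
    excludes no case and gives a finite type. *)
Definition hermite_index n :=
  {i : 'I_n.+1 * 'I_n.+1 | (i.1 %| n)%N && (i.2 < i.1)%N}.

(** Each divisor [c] of [n] allows the [c] values [0], ..., [c - 1] of [b]. *)
Lemma sigma_card n : (0 < n)%N -> sigma n = #|{: hermite_index n}|.
Proof.
move=> n_gt0; rewrite card_sig -sum1_card.
rewrite (eq_bigl (fun i : 'I_n.+1 * 'I_n.+1 =>
  (i.1 %| n)%N && (i.2 < i.1)%N)) //.
rewrite -(pair_big_dep (fun i : 'I_n.+1 => i %| n)%N
  (fun i j : 'I_n.+1 => j < i)%N (fun _ _ => 1%N)) /=.
transitivity (\sum_(i < n.+1 | (i %| n)%N) i)%N; last first.
  apply: eq_bigr => i _.
  rewrite -(big_ord_widen_cond n.+1 xpredT (fun=> 1%N)) 1?ltnW //.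
  by rewrite sum1_card card_ord.
rewrite -(big_mkord (fun i => i %| n)%N id) -big_filter /sigma.
apply: perm_big; apply: uniq_perm;
  rewrite ?divisors_uniq ?filter_uniq ?iota_uniq //.
move=> d; rewrite mem_filter -dvdn_divisors // mem_index_iota /= ltnS.
by apply/idP/andP => [dn|[]//]; split=> //; apply: dvdn_leq.
Qed.

(** * Subgroups and the union of projective spaces *)

Section Components.

Variables (n : nat) (n_gt0 : (0 < n)%N).
Implicit Type u : PF1_union n.

Let degree u : nat := sval (tag u).
Let scale u : nat := Nat.sqrt (n %/ degree u)%N.
Let direction u : int * int := sval (repr (tagged u)).

Let decomp u := square_codivisor_decomp n_gt0
  (proj1 (svalP (tag u))) (proj2 (svalP (tag u))).

Let direction_prim u : coprimez (direction u).1 (direction u).2.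
Proof. exact: svalP (repr (tagged u)). Qed.

Let component_lattice u := smith_lattice (scale u) (degree u) (direction u).

Let component_card_eq u : [set: Quotient.quot (component_lattice u)] #= `I_n.
Proof.
have [k_gt0 d_gt0 _ Dn] := decomp u; rewrite [n in `I_n]Dn.
exact: smith_card_eq.
Qed.

(** The inverse of the bijection in the theorem. By [eq_smith_lattice] only the class of the
    direction matters. *)
Definition component_subgroup u : subgroup_of_index n :=
  exist _ (component_lattice u) (component_card_eq u).

Lemma subgroup_of_index_ext (M N : subgroup_of_index n) :
  sval M =i sval N -> M = N.
Proof.
case: M N => [M M_n] [N N_n] /= /zmodClosed_ext eqMN.
by case: _ / eqMN in N_n *; congr exist; apply: Prop_irrelevance.
Qed.

Lemma component_subgroup_bijective : bijective component_subgroup.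
Proof.
apply: inj_surj_bijective => [u u' eq_u|M].
  have [k_gt0 d_gt0 _ Dn] := decomp u; have [k'_gt0 _ _ Dn'] := decomp u'.
  have eqM : component_lattice u =i component_lattice u'.
    move=> v.
    by rewrite -[component_lattice u]/(sval (component_subgroup u)) eq_u.
  have [] := smith_lattice_inj k_gt0 k'_gt0 d_gt0 (direction_prim u)
    (direction_prim u') (etrans (esym Dn) Dn') eqM.
  move=> _; rewrite /degree /direction.
  case: u u' {eq_u k_gt0 d_gt0 Dn k'_gt0 Dn' eqM} =>
    [[d dP] q] [[d' dP'] q'] /=.
  (* The equality of degrees is eliminated first, because the types of [q] and [q'] depend on it. *)
  move=> eq_d; case: _ / eq_d in dP' q' *.
  rewrite (Prop_irrelevance dP' dP) => dvd_det; congr existT.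
  by rewrite -[q]reprK -[q']reprK; apply/eqmodP.
have [a [c [b [a_gt0 lt_bc eqM]]]] := finite_index_hermite (svalP M).
have c_gt0 : (0 < c)%N by apply: leq_ltn_trans lt_bc.
have [k [d [p [k_gt0 d_gt0 p_prim Dac eqH]]]] := hermite_smith b%:Z a_gt0 c_gt0.
have Dn : n = (d * k * k)%N.
  rewrite -Dac; apply/card_eq_II/(card_eq_trans (card_esym (svalP M))).
  by rewrite (zmodClosed_ext eqM); apply: hermite_card_eq.
have dP : (d %| n)%N /\ is_square (n %/ d)%N.
  by rewrite Dn -mulnA mulKn // dvdn_mulr //; split=> //; exists k.
pose q : primitive_pair := exist _ p p_prim.
exists (existT _ (exist _ d dP) (\pi_(PF1 d) q)).
apply: subgroup_of_index_ext => v.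
rewrite eqM eqH -[sval _]/(component_lattice _) /component_lattice.
set u := existT _ _ _.
have -> : scale u = k.
  rewrite /scale /degree /= Dn -mulnA mulKn //.
  exact: PeanoNat.Nat.sqrt_square.
(* The representative chosen in the class of [p] is only congruent to [p], which leaves the lattice
   unchanged. *)
apply: eq_smith_lattice => //.
by have /eqmodP := reprK (\pi_(PF1 d) q).
Qed.

End Components.

(** * Counting subgroups by Hermite bases *)

Lemma hermite_subgroups_bijective n : (0 < n)%N ->
  exists f : hermite_index n -> subgroup_of_index n, bijective f.
Proof.
move=> n_gt0.
have idxP (i : hermite_index n) : [/\ (0 < n %/ (val i).1)%N,
    (0 < (val i).1)%N, ((val i).2 < (val i).1)%N &
    (n %/ (val i).1 * (val i).1 = n)%N].
  have /andP[cn bc] := valP i; have c_gt0 := leq_ltn_trans (leq0n _) bc.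
  by rewrite divn_gt0 // dvdn_leq // divnK.
have card_n (i : hermite_index n) :
    [set: Quotient.quot (hermite_lattice (n %/ (val i).1)%N
      (val i).1 (val i).2%:Z)] #= `I_n.
  have [a_gt0 c_gt0 _ Dn] := idxP i; rewrite -[n in `I_n]Dn.
  exact: hermite_card_eq.
exists (fun i => exist
  (fun M : zmodClosed (int * int)%type => [set: Quotient.quot M] #= `I_n)
  _ (card_n i)).
apply: inj_surj_bijective => [i j eq_ij|M].
  have [a_gt0 c_gt0 bc Dn] := idxP i; have [a'_gt0 c'_gt0 bc' Dn'] := idxP j.
  have /= eqH := congr1 sval eq_ij.
  have [|eq_c eq_b] := hermite_inj a_gt0 c_gt0 bc bc' (etrans Dn (esym Dn')).
    by rewrite eqH.
  apply: val_inj; rewrite [val i]surjective_pairing [val j]surjective_pairing.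
  by rewrite (val_inj eq_c) (val_inj eq_b).
have [a [c [b [a_gt0 lt_bc eqM]]]] := finite_index_hermite (svalP M).
have c_gt0 : (0 < c)%N by apply: leq_ltn_trans lt_bc.
have Dn : n = (a * c)%N.
  apply/card_eq_II/(card_eq_trans (card_esym (svalP M))).
  by rewrite (zmodClosed_ext eqM); apply: hermite_card_eq.
have le_cn : (c < n.+1)%N by rewrite ltnS Dn leq_pmull.
have le_bn : (b < n.+1)%N by apply: ltn_trans le_cn.
have iP : (c %| n)%N && (b < c)%N by rewrite lt_bc Dn dvdn_mull.
exists (exist _ (Ordinal le_cn, Ordinal le_bn) iP).
by apply: subgroup_of_index_ext => v; rewrite eqM /= Dn mulnK.
Qed.

Theorem theorem3p2 (n : nat) (n_ge1 : (1 <= n)%N) :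
  exists Phi : subgroup_of_index n -> PF1_union n,
    [/\ bijective Phi,
        forall M : subgroup_of_index n,
          (in_component Phi M n <->
             exists a b : int, (a, b) \in sval M /\ gcdz a b = 1) /\
          ((exists a b : int, (a, b) \in sval M /\ gcdz a b = 1) <->
             finite_set [set: Z2_quot M] /\ zmod_cyclic (Z2_quot M)),
        forall d : nat, (d %| n)%N -> is_square (n %/ d)%N ->
          forall M : subgroup_of_index n,
            in_component Phi M d <->
            zmod_iso (Z2_quot M)
              (Zmod (Nat.sqrt (n %/ d)%N) * Zmod (Nat.sqrt (n * d)%N))%type
      & exists f : 'I_(sigma n) -> subgroup_of_index n, bijective f].
Proof.
have [Phi PsiK PhiK] := component_subgroup_bijective n_ge1.
(* Writing [M] as the image of [u = Phi M] turns each claim into one about a Smith lattice. *)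
have surj M : exists2 u, Phi M = u & M = component_subgroup n_ge1 u.
  by exists (Phi M).
exists Phi; split; first by exists (component_subgroup n_ge1).
- move=> M; rewrite /in_component; have [u -> ->] := surj M.
  have [dn dsq] := svalP (tag u).
  have [k_gt0 d_gt0 _ Dn] := square_codivisor_decomp n_ge1 dn dsq.
  have u_prim := svalP (repr (tagged u)).
  have prim1 := smith_primitive (sval (tag u)) k_gt0 u_prim.
  have cyc1 := @smith_cyclic (Nat.sqrt (n %/ sval (tag u))%N)
    (sval (tag u)) _ u_prim.
  (* Each condition of the first item amounts to [k = 1] in [n = d * k * k], that is [d = n]. *)
  split; [apply: iff_trans (iff_sym prim1)|apply: iff_trans prim1 _].
    split=> [->|k1]; last by move: Dn; rewrite k1 !muln1 => /esym.
    by rewrite divnn n_ge1; exact: PeanoNat.Nat.sqrt_1.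
  apply: iff_trans (iff_sym cyc1) _; split=> [cyc|[] //]; split=> //.
  by exists n; exact: svalP (component_subgroup n_ge1 u).
- move=> d dn dsq M; rewrite /in_component; have [u -> ->] := surj M.
  have [k_gt0 d_gt0 -> Dn] := square_codivisor_decomp n_ge1 dn dsq.
  have [dn' dsq'] := svalP (tag u).
  have [k'_gt0 d'_gt0 _ Dn'] := square_codivisor_decomp n_ge1 dn' dsq'.
  have iso := smith_iso (Nat.sqrt (n %/ sval (tag u))%N) (sval (tag u))
    (svalP (repr (tagged u))).
  (* Conversely, the quotient would be isomorphic to the groups of both degrees, which have the same
     order [n]. *)
  split=> [<-//|/(zmod_iso_trans (zmod_iso_sym iso))].
  by apply: Zmod_pair_iso_inj; rewrite // -Dn -Dn'.
have [f f_bij] := hermite_subgroups_bijective n_ge1.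
rewrite sigma_card //; exists (f \o enum_val).
exact: bij_comp f_bij (enum_val_bij _).
Qed.
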